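(* Let $X,Y$ be Banach spaces, $p>1$ with conjugate exponent $p_*$, $A\colon X\to Y$ bounded linear, $\mathcal{R}\colon X\to[0,+\infty]$ convex, lower semi-continuous and coercive, $y^\dagger\in Y$, and let $x^\dagger$ be an $\mathcal{R}$-minimising solution of $Ax=y^\dagger$. Assume that $\omega^\dagger\in Y^*$ satisfies $A^*\omega^\dagger\in\partial\mathcal{R}(x^\dagger)$. Assume that $\mathcal{R}$ is two times Fréchet differentiable at $x^\dagger$ and that $J_{p_*}(\omega^\dagger)\in\operatorname{Ran}A$. Then there exists $C>0$ such that $$\langle\omega-\omega^\dagger,J_{p_*}(\omega^\dagger)\rangle\le C\bigl(\mathcal{D}^*_{x^\dagger}(A^*\omega;A^*\omega^\dagger)\bigr)^{1/2}$$ for all $\omega\in Y^*$ sufficiently close to $\omega^\dagger$.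
   Context: Conventions: $\langle\cdot,\cdot\rangle$ is the dual pairing; $1/p+1/p_*=1$; $A^*\colon Y^*\to X^*$ is the adjoint; $\operatorname{Ran}A$ is the range of $A$; coercive means $\mathcal{R}(x)\to\infty$ as $\|x\|\to\infty$; $\partial\mathcal{R}$ is the convex subdifferential. An $\mathcal{R}$-minimising solution of $Ax=y^\dagger$ is an element $x^\dagger\in\arg\min\{\mathcal{R}(x):Ax=y^\dagger\}$. $\mathcal{R}^*\colon X^*\to(-\infty,+\infty]$ is the convex conjugate of $\mathcal{R}$ (the condition $A^*\omega^\dagger\in\partial\mathcal{R}(x^\dagger)$ implies $x^\dagger\in\partial\mathcal{R}^*(A^*\omega^\dagger)$), and the dual Bregman distance is $\mathcal{D}^*_{x^\dagger}(\xi;A^*\omega^\dagger)=\mathcal{R}^*(\xi)-\mathcal{R}^*(A^*\omega^\dagger)-\langle\xi-A^*\omega^\dagger,x^\dagger\rangle\in[0,+\infty]$. The inequality is trivially satisfied where $\mathcal{D}^*_{x^\dagger}=+\infty$. Duality mapping on $Y^*$: $J_{p_*}(\omega^\dagger)$ is the element $y\in Y$ with $\langle\omega^\dagger,y\rangle=\|\omega^\dagger\|\|y\|$ and $\|y\|=\|\omega^\dagger\|^{p_*-1}$ (such an element is assumed to exist; if there are several, $J_{p_*}(\omega^\dagger)$ denotes one fixed choice). *)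

(* Defs.v *)
From HB Require Import structures.
From mathcomp Require Import all_boot all_order all_algebra.
From mathcomp Require Import all_classical all_reals all_analysis.

Set Implicit Arguments.
Unset Strict Implicit.
Unset Printing Implicit Defensive.

Import Order.TTheory GRing.Theory Num.Theory.
Import numFieldNormedType.Exports.

Local Open Scope classical_set_scope.
Local Open Scope ring_scope.

Section ContinuousDual.
Context {K : realType} {V : normedModType K}.

Definition cdual_pred : {pred V -> K^o} :=
  fun f : V -> K^o => `[< linear f /\ continuous f >].

Lemma cdual_pred_submod_closed : submod_closed cdual_pred.
Proof.
split => [|k f g /asboolP[lf cf] /asboolP[lg cg]]; apply/asboolP; split.
- by move=> a u v /=; rewrite scaler0 addr0.
- by move=> x; exact: cvg_cst.
- move=> a u v /=; rewrite !fctE lf lg.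
  by rewrite !scalerDr !scalerA (mulrC k) addrACA.
- by move=> x; apply: cvgD; [apply: cvgZr|]; [exact: cf|exact: cg].
Qed.

HB.instance Definition _ :=
  GRing.isSubmodClosed.Build _ _ cdual_pred cdual_pred_submod_closed.

End ContinuousDual.

(* The continuous dual V^* of a real normed space; its norm, put on it below,
   is the operator norm. *)
Record cdual (K : realType) (V : normedModType K) := CDual {
  cdual_fun :> V -> K^o;
  cdual_funP : cdual_fun \in cdual_pred }.

Section DualNorm.
Context {K : realType} {V : normedModType K}.

HB.instance Definition _ := [isSub for @cdual_fun K V].
HB.instance Definition _ := [Choice of cdual V by <:].
HB.instance Definition _ := [SubChoice_isSubLmodule of cdual V by <:].

Definition cdual_norm (f : cdual V) : K :=
  sup [set `|f x| | x in [set x : V | `|x| <= 1]].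

Lemma cdual_linear (f : cdual V) : linear f.
Proof. by have /asboolP[] := cdual_funP f. Qed.

Lemma cdual_continuous (f : cdual V) : continuous f.
Proof. by have /asboolP[] := cdual_funP f. Qed.

HB.instance Definition _ (f : cdual V) :=
  GRing.isLinear.Build K V K^o _ f (cdual_linear f).

Lemma cdual_has_sup (f : cdual V) :
  has_sup [set `|f x| | x in [set x : V | `|x| <= 1]].
Proof.
split; first by exists `|f 0|, 0 => //=; rewrite normr0.
have /linear_boundedP : bounded_near f (nbhs (0 : V)).
  exact/linear_bounded_continuous/cdual_continuous.
move=> [M [Mr fM]]; exists (`|M| + 1) => _ [x /= x1 <-].
have M1 : M < `|M| + 1 by rewrite ltr_pwDr// ler_norm.
by rewrite (le_trans (fM _ M1 x))// ler_piMr// addr_ge0.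
Qed.

Lemma cdual_norm_ub (f : cdual V) (x : V) : `|x| <= 1 -> `|f x| <= cdual_norm f.
Proof.
by move=> x1; apply: sup_upper_bound; [exact: cdual_has_sup|exists x].
Qed.

Lemma cdual_norm_le (f : cdual V) (M : K) :
  (forall x : V, `|x| <= 1 -> `|f x| <= M) -> cdual_norm f <= M.
Proof.
move=> fM; apply: ge_sup; first exact: (cdual_has_sup f).1.
by move=> _ [x /= x1 <-]; exact: fM.
Qed.

Lemma cdual_norm_ge0 (f : cdual V) : 0 <= cdual_norm f.
Proof. by rewrite (le_trans (normr_ge0 (f 0)))// cdual_norm_ub// normr0. Qed.

Lemma cdual_normP (f : cdual V) (x : V) : `|f x| <= cdual_norm f * `|x|.
Proof.
have [->|x0] := eqVneq x 0; first by rewrite linear0 !normr0 mulr0.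
have nx0 : 0 < `|x| by rewrite normr_gt0.
rewrite -ler_pdivrMr//.
have -> : `|f x| / `|x| = `|f (`|x|^-1 *: x)|.
  by rewrite linearZ normrZ normfV normr_id mulrC.
by apply: cdual_norm_ub; rewrite normrZ normfV normr_id mulVf// gt_eqF.
Qed.

Lemma cdual_ler_normD (f g : cdual V) :
  cdual_norm (f + g) <= cdual_norm f + cdual_norm g.
Proof.
apply: cdual_norm_le => x x1.
by rewrite (le_trans (ler_normD (f x) (g x)))// lerD// cdual_norm_ub.
Qed.

Lemma cdual_normrZ (k : K) (f : cdual V) :
  cdual_norm (k *: f) = `|k| * cdual_norm f.
Proof.
have le (l : K) (g : cdual V) : cdual_norm (l *: g) <= `|l| * cdual_norm g.
  apply: cdual_norm_le => x x1.
  by rewrite (normrM l (g x)) ler_wpM2l// cdual_norm_ub.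
apply/eqP; rewrite eq_le le /=.
have [->|k0] := eqVneq k 0; first by rewrite normr0 mul0r cdual_norm_ge0.
rewrite -ler_pdivlMl ?normr_gt0// -normfV.
by rewrite (le_trans _ (le _ _))// scalerA mulVf// scale1r.
Qed.

Lemma cdual_normr0_eq0 (f : cdual V) : cdual_norm f = 0 -> f = 0.
Proof.
move=> f0; apply/val_inj/funext => x /=; apply/eqP.
by rewrite -normr_le0 (le_trans (cdual_normP f x))// f0 mul0r.
Qed.

HB.instance Definition _ := Lmodule_isNormed.Build K (cdual V)
  cdual_ler_normD cdual_normrZ cdual_normr0_eq0.

End DualNorm.

Section Adjoint.
Context {K : realType} {V W : normedModType K}.
Variables (A : {linear V -> W}) (bA : bounded_near A (nbhs (0 : V))).

Lemma adjoint_subproof (w : cdual W) : (w : W -> K^o) \o A \in cdual_pred.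
Proof.
apply/asboolP; split; first by move=> a u v /=; rewrite !linearP.
move=> x; apply: continuous_comp; last exact: cdual_continuous.
exact: bounded_linear_continuous.
Qed.

Definition adjoint (w : cdual W) : cdual V := CDual (adjoint_subproof w).

End Adjoint.

Section ConvexFunctionals.
Context {K : realType} {V : normedModType K}.
Implicit Types (F : V -> \bar K) (x : V) (xi : cdual V).
Local Open Scope ereal_scope.

(* Only meant for functionals that do not take the value -oo. *)
Definition econvex F := forall x y (t : K), (0 <= t <= 1)%R ->
  F (t *: x + (1 - t) *: y)%R <= t%:E * F x + (1 - t)%:E * F y.

Definition coercive F :=
  forall M : K, exists r : K, forall x, (r <= `|x|)%R -> M%:E <= F x.

Definition subdiff F x : set (cdual V) :=
  [set xi | F x \is a fin_num /\ forall z, F x + (xi (z - x)%R)%:E <= F z].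

Definition conjugate F xi : \bar K := ereal_sup [set (xi x)%:E - F x | x in setT].

(* The dual Bregman distance D^*_x(xi; xi0), meant for xi0 in subdiff F x. *)
Definition dual_bregman F x xi xi0 : \bar K :=
  conjugate F xi - conjugate F xi0 - ((xi - xi0)%R x)%:E.

(* F is finite near x, and its Frechet derivative, as a map from a
   neighbourhood of x to the dual with the operator norm, is itself Frechet
   differentiable at x.  The values of dF far from x are irrelevant. *)
Definition twice_frechet_differentiable F x :=
  (\forall z \near x, F z \is a fin_num) /\
  exists dF : V -> cdual V,
    (\forall z \near x, is_diff z (fine \o F : V -> K^o) (dF z)) /\
    differentiable dF x.

End ConvexFunctionals.

Definition minimising_solution (K : realType) (V W : normedModType K)
    (F : V -> \bar K) (A : V -> W) (y : W) : set V :=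
  [set x | A x = y /\ forall z, A z = y -> (F x <= F z)%E].

(* The values of the (set-valued) duality mapping J_q on the dual, as elements
   of the space itself; this set may be empty. *)
Definition duality_mapping (K : realType) (V : normedModType K) (q : K)
    (w : cdual V) : set V :=
  [set y | w y = `|w| * `|y| /\ `|y| = `|w| `^ (q - 1)].

(* Main.v *)
(* Write J(w0) = A v and n = <w - w0, A v>; only n > 0 matters.  Testing the
   conjugate at x + t v and using that F has a second-order upper expansion at x
   with slope A^* w0 gives D >= n t - M t^2 for all small t > 0, and t = n / (2M)
   yields D >= n^2 / (4M); this t is admissible when w is close to w0. *)

Require Import Defs.
From mathcomp Require Import all_boot all_order all_algebra.
From mathcomp Require Import all_classical all_reals all_analysis.
From mathcomp Require Import ring lra.

Import Order.TTheory GRing.Theory Num.Theory.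
Import numFieldNormedType.Exports.

Local Open Scope classical_set_scope.
Local Open Scope ring_scope.

Lemma near_line (K : numFieldType) (V : normedModType K) (x v : V) (P : set V) :
  (\forall z \near x, P z) ->
  exists2 d : K, 0 < d & forall t : K, `|t| < d -> P (x + t *: v).
Proof.
move=> /nbhs0P/(near0Z v)/nbhs_ballP[d d0 dP]; exists d => // t td.
by apply: dP; rewrite /ball/= sub0r normrN.
Qed.

(** The difference quotient along the line is, term by term, the one that defines the derivative of
    [f] at [x + t *: v] in direction [v]. *)
Lemma is_derive_line (K : numFieldType) (V W : normedModType K)
    (f df : V -> W) (x v : V) (t : K) :
  is_diff (x + t *: v) f df -> is_derive t 1 (fun s => f (x + s *: v)) (df v).
Proof.
move=> [fx <-].
have E : (fun h : K => h^-1 *: (((fun s => f (x + s *: v)) \o shift t) (h *: 1)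
      - f (x + t *: v))) =
    (fun h => h^-1 *: ((f \o shift (x + t *: v)) (h *: v) - f (x + t *: v))).
  apply/funext => h /=; congr (_ *: (f _ - _)).
  by rewrite scaler1 scalerDl addrCA.
split; first by rewrite /derivable E; exact: diff_derivable.
by rewrite /derive E -/(derive f _ _) deriveE.
Qed.

(** The difference quotients in direction [v] converge to some [l], so their norms are eventually at
    most [|l| + 1]. *)
Lemma differentiable_line_lipschitz (K : numFieldType) (V W : normedModType K)
    (g : V -> W) (x v : V) :
  differentiable g x -> exists2 L : K, 0 < L &
    \forall t \near (0 : K), `|g (x + t *: v) - g x| <= L * `|t|.
Proof.
move=> gx; have /cvg_ex[l gl] := @diff_derivable _ _ _ g x v gx.
exists (`|l| + 1); first by rewrite ltr_wpDl.
have l1 : `|l| < `|l| + 1 by rewrite ltrDl.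
have /cvgr_norm_le/(_ _ l1) := gl.
rewrite /dnbhs near_withinE; apply: filterS => t tl.
have [->|t0] := eqVneq t 0; first by rewrite scale0r addr0 subrr !normr0 mulr0.
have := tl t0; rewrite /= normrZ normfV (addrC (t *: v)).
by rewrite ler_pdivrMl ?normr_gt0// mulrC.
Qed.

Section QuadraticBound.
Context {K : realType} {V : normedModType K}.
Variables (f : V -> K^o) (df : V -> cdual V) (x v : V) (xi : cdual V).
Hypothesis fdf : \forall z \near x, is_diff z f (df z).
Hypothesis dfx : differentiable df x.
Hypothesis fxi : \forall z \near x, f x + xi (z - x) <= f z.

(* [t |-> f (x + t v) - t xi v] is minimal at 0, so its derivative, which grows
   at most linearly, vanishes there; conclude by the mean value theorem. *)
Lemma frechet_taylor2_ub : exists2 M : K, 0 < M &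
  \forall t \near 0^'+, f (x + t *: v) <= f x + t * xi v + M * t ^+ 2.
Proof.
have [d d0 dfdf] := near_line _ _ _ v _ fdf.
have [e e0 exi] := near_line _ _ _ v _ fxi.
have [L L0 /nbhs_ballP[r r0 rL]] := differentiable_line_lipschitz _ _ _ _ x v dfx.
pose g (t : K) : K := f (x + t *: v).
pose h : K -> K := g - xi v *: (id : K -> K).
have hE (t : K) : `|t| < d -> is_derive t 1 h (df (x + t *: v) v - xi v).
  move=> td.
  have gt : is_derive t 1 g (df (x + t *: v) v) by apply: is_derive_line; exact: dfdf.
  by apply: is_derive_eq; rewrite /GRing.scale /= mulr1.
have h'0 : df x v - xi v = 0.
  pose m := Num.min d e.
  have m0 : 0 < m by rewrite lt_min d0.
  have h0 : is_derive (0 : K) 1 h 0.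
    apply: (@derive1_at_min _ h (- m) m).
    - lra.
    - move=> t; rewrite in_itv/= -ltr_norml lt_min => /andP[td _].
      by have := hE t td => -[].
    - by rewrite in_itv/= m0 oppr_lt0 m0.
    - move=> t; rewrite in_itv/= -ltr_norml lt_min => /andP[_ te].
      rewrite /h /g !fctE /= scale0r addr0 scaler0 subr0 -mulNr.
      have := exi t te; rewrite (addrC x) addrK linearZ /= /GRing.scale /=.
      by lra.
  (* [h0] and [h1] give two values for the derivative of [h] at 0, which must agree. *)
  have := hE 0; rewrite normr0 scale0r addr0 => /(_ d0) h1.
  by rewrite -(@derive_val _ _ _ _ _ _ _ h0) (@derive_val _ _ _ _ _ _ _ h1).
(* [L * |v|] bounds the growth rate of the derivative of [h]; adding 1 keeps the constant positive
   even if [v = 0]. *)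
exists (L * `|v| + 1); first by rewrite ltr_wpDl// mulr_ge0// ltW.
near=> t.
have t0 : 0 < t by near: t; exact: nbhs_right_gt.
have td : t < d by near: t; exact: nbhs_right_lt.
have tr : t < r by near: t; exact: nbhs_right_lt.
have st s : 0 <= s <= t -> `|s| < d.
  by move=> /andP[s0 st]; rewrite ger0_norm// (le_lt_trans st).
have [s||c] := @MVT _ h (fun s => df (x + s *: v) v - xi v) 0 t t0.
- by rewrite in_itv/= => /andP[s0 st']; apply/hE/st; rewrite !ltW.
- apply: derivable_within_continuous => s; rewrite in_itv/= => sI.
  by have [] := hE s (st s sI).
rewrite in_itv/= => /andP[c0 ct] hc.
(* The operator norm turns the Lipschitz bound on [df] along the line into a bound on its values at
   [v]. *)
have dc : `|df (x + c *: v) v - df x v| <= L * c * `|v|.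
  apply: (le_trans (cdual_normP (df (x + c *: v) - df x) v)).
  rewrite ler_wpM2r//.
  have := rL c; rewrite /ball/= sub0r normrN gtr0_norm//.
  by apply; exact: lt_trans tr.
move: dc; rewrite (subr0_eq h'0) => /(le_trans (ler_norm _)).
move=> dc; move: hc; rewrite /h /g !fctE /= scale0r addr0 scaler0 !subr0 /GRing.scale /= => hc.
have : (df (x + c *: v) v - xi v) * t <= L * t * `|v| * t.
  rewrite ler_wpM2r ?(ltW t0)// (le_trans dc)// ler_wpM2r// ler_wpM2l// ltW//.
have t2 : 0 <= t ^+ 2 by exact: sqr_ge0.
by lra.
Unshelve. all: by end_near. Qed.
End QuadraticBound.

(** The nontrivial half of equality in Fenchel-Young: rearranged, the subgradient inequality says
    that [xi z - F z] is largest at [z = x]. *)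
Lemma conjugate_ub (K : realType) (V : normedModType K) (F : V -> \bar K)
    (x : V) (xi : cdual V) :
  subdiff F x xi -> (conjugate F xi <= (xi x)%:E - F x)%E.
Proof.
move=> [Fx Fxi]; apply: ge_ereal_sup => _ [z _ <-].
have := Fxi z; rewrite -(fineK Fx).
case: (F z) => [s| |]//=.
- rewrite -!EFinD !lee_fin linearB /=; lra.
- by rewrite leNye.
Qed.

(** Bound [conjugate F xi] below by its competitor at [z] and [conjugate F xi0] above by
    [conjugate_ub]; the terms [xi0 x] then cancel. *)
Lemma dual_bregman_lb (K : realType) (V : normedModType K) (F : V -> \bar K)
    (x z : V) (xi xi0 : cdual V) : F z \is a fin_num -> subdiff F x xi0 ->
  ((xi (z - x) + fine (F x) - fine (F z))%:E
    <= dual_bregman F x xi xi0)%E.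
Proof.
move=> Fz sub; have [Fx _] := sub; have := conjugate_ub _ _ _ _ _ sub.
have : ((xi z)%:E - F z <= conjugate F xi)%E by apply: ereal_sup_ubound; exists z.
rewrite /dual_bregman -(fineK Fx) -(fineK Fz) /=.
case: (conjugate F xi) => [a| |]; case: (conjugate F xi0) => [b| |]//=.
(* In the infinite cases that survive, the Bregman distance is [+oo]. *)
- rewrite -!EFinD !lee_fin !fctE linearB /=. lra.
all: by move=> *; exact: leey.
Qed.

Theorem lemma5p3 (K : realType) (X Y : completeNormedModType K)
    (p q : K) (p1 : 1 < p) (pq : p^-1 + q^-1 = 1)
    (A : {linear X -> Y}) (bA : bounded_near A (nbhs (0 : X)))
    (F : X -> \bar K) (F0 : forall x, (0 <= F x)%E)
    (convF : econvex F) (lscF : lower_semicontinuous F) (coerF : coercive F)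
    (ydag : Y) (xdag : X) (xdagP : minimising_solution F A ydag xdag)
    (wdag : cdual Y) (wdagP : subdiff F xdag (adjoint bA wdag))
    (F2 : twice_frechet_differentiable F xdag)
    (jw : Y) (jwP : duality_mapping q wdag jw) (jwA : range A jw) :
  exists2 C : K, 0 < C &
    \forall w \near wdag,
      (((w - wdag) jw)%:E <=
        C%:E * (dual_bregman F xdag (adjoint bA w) (adjoint bA wdag)) `^ 2^-1)%E.
Proof.
have [v _ Av] := jwA; rewrite -{}Av.
have [Ffin [dF [fdF dFx]]] := F2.
have fsub : \forall z \near xdag,
    fine (F xdag) + adjoint bA wdag (z - xdag) <= fine (F z).
  have [Fx Fsub] := wdagP; apply: filterS Ffin => z Fz.
  by have := Fsub z; rewrite -{1}(fineK Fx) -(fineK Fz) -EFinD lee_fin.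
have [M M0 [d /= d0 dM]] :=
  frechet_taylor2_ub (fine \o F) dF xdag v _ fdF dFx fsub.
have [e e0 eF] : exists2 e : K, 0 < e &
    forall t, `|t| < e -> F (xdag + t *: v) \is a fin_num.
  exact: near_line _ _ xdag v _ Ffin.
(* Chosen so that [|w - wdag| < m] forces [n / (2 * M) < Num.min d e], as [n <= |w - wdag| * |A v|];
   the 1 avoids dividing by zero. *)
pose m := Num.min d e * (2 * M) / (1 + `|A v|).
have Av0 : 0 < 1 + `|A v| by rewrite ltr_pwDl.
have m0 : 0 < m by rewrite divr_gt0// mulr_gt0 ?lt_min ?d0//; lra.
(* This is the constant obtained by solving [n ^+ 2 / (4 * M) <= D] for [n]. *)
exists (2 * Num.sqrt M); first by rewrite mulr_gt0// sqrtr_gt0.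
near=> w.
set D := dual_bregman _ _ _ _.
have [n0|n0] := leP ((w - wdag) (A v)) 0.
  rewrite (@le_trans _ _ 0%E) ?lee_fin//.
  by rewrite mule_ge0 ?poweR_ge0// lee_fin mulr_ge0// sqrtr_ge0.
pose n : K := (w - wdag) (A v); pose t := n / (2 * M).
rewrite -/n in n0 *.
have t0 : 0 < t by rewrite divr_gt0//; lra.
have : t < Num.min d e.
  rewrite /t ltr_pdivrMr; last lra.
  have wm : `|w - wdag| < m by near: w; exact: cvgr_distC_lt.
  rewrite -(ltr_pM2r (_ : 0 < (1 + `|A v|)^-1)) ?invr_gt0// -/m.
  apply: le_lt_trans wm; rewrite ler_pdivrMr//.
  rewrite (le_trans (ler_norm _))// (le_trans (cdual_normP _ _))//.
  by rewrite ler_wpM2l// ?lerDr//; exact: cdual_norm_ge0.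
rewrite lt_min => /andP[td te].
have Dlb : ((n ^+ 2 / (4 * M))%:E <= D)%E.
  have Ft : F (xdag + t *: v) \is a fin_num by apply: eF; rewrite gtr0_norm.
  have := @dual_bregman_lb _ _ F _ _ (adjoint bA w) _ Ft wdagP.
  apply: le_trans; rewrite lee_fin.
  have := dM t; rewrite /= sub0r normrN gtr0_norm// => /(_ td t0).
  rewrite (addrC xdag) addrK !linearZ /= /GRing.scale /=.
  have -> : w (A v) = n + wdag (A v) by apply: esym; exact: subrK.
  (* The chosen [t] maximises [t * n - M * t ^+ 2], the bound left once the slope [wdag (A v)]
     cancels. *)
  have -> : n ^+ 2 / (4 * M) = t * n - M * t ^+ 2 by rewrite /t; field; lra.
  lra.
have nE : (n%:E = (2 * Num.sqrt M)%:E * ((n ^+ 2 / (4 * M))%:E `^ 2^-1))%E.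
  rewrite poweR_EFin -EFinM; congr EFin.
  have sM : 0 < Num.sqrt M by rewrite sqrtr_gt0.
  have -> : n ^+ 2 / (4 * M) = (n / (2 * Num.sqrt M)) ^+ 2.
    rewrite -{1}(sqr_sqrtr (ltW M0)); field; lra.
  rewrite powR12_sqrt ?sqr_ge0// sqrtr_sqr gtr0_norm; last first.
    by rewrite divr_gt0// mulr_gt0.
  by field; lra.
(* With [n] written as a multiple of a square root, only monotonicity of the extended square root on
   [[0, +oo]] remains, which includes [D = +oo]. *)
rewrite [leLHS]nE lee_pmul2l//; last by rewrite lte_fin mulr_gt0// sqrtr_gt0.
have q0 : 0 <= n ^+ 2 / (4 * M) by rewrite divr_ge0 ?sqr_ge0//; lra.
apply: gt0_ler_poweR => //; rewrite in_itv/= leey andbT ?lee_fin//.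
exact: le_trans Dlb.
Unshelve. all: by end_near. Qed.
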